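(* For all $p,\ell\in\mathbb{N}$, \[ \mu_{p,f}^\ell\,\mathrm{SSAC}(f)=\sum_{\mathcal{P}\in\mathrm{Con}(p)}\left|\mathrm{As}(\mathcal{P},=,\ell)\right|. \]
   Context: $\mathbb{N}=\{0,1,2,\ldots\}$ and $[n]=\{0,1,\ldots,n-1\}$ for $n\in\mathbb{N}$. Sequences: a binary sequence of length $\ell$ is a doubly infinite list $f=(f_j)_{j\in\mathbb{Z}}$ with $f_j\in\{-1,1\}$ for $j\in[\ell]$ and $f_j=0$ otherwise; $\mathrm{Seq}(\ell)$ is the set of all $2^\ell$ of them with uniform probability measure. $C_f(s)=\sum_{j\in\mathbb{Z}}f_{j+s}\overline{f_j}$ for $s\in\mathbb{Z}$, and $\mathrm{SSAC}(f)=\sum_{s\in\mathbb{Z}}|C_f(s)|^2$. With $\mathbb{E}_f^\ell$ the expectation over $f\in\mathrm{Seq}(\ell)$, the $p$th central moment is $\mu_{p,f}^\ell v(f)=\mathbb{E}_f^\ell\big(v(f)-\mathbb{E}_f^\ell v(f)\big)^p$. Partitions: a partition of a set is a collection of nonempty pairwise disjoint subsets (classes) whose union is the set. $\mathrm{Part}(p)$ is the set of partitions of $[p]\times[2]\times[2]$. For $\mathcal{P}\in\mathrm{Part}(p)$, $\mathrm{As}(\mathcal{P},=)$ is the set of functions $\tau\colon[p]\times[2]\times[2]\to\mathbb{N}$, written $(e,s,v)\mapsto\tau_{esv}$, such that (a) $\tau_\beta=\tau_\gamma$ if and only if $\beta,\gamma$ lie in the same class of $\mathcal{P}$, and (b)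 $\tau_{e00}+\tau_{e01}=\tau_{e10}+\tau_{e11}$ for every $e\in[p]$. $\mathrm{As}(\mathcal{P},=,\ell)$ is the set of $\tau\in\mathrm{As}(\mathcal{P},=)$ with all values in $[\ell]$. $\mathcal{P}$ is satisfiable if $\mathrm{As}(\mathcal{P},=)\ne\emptyset$. A partition is even if all of its classes have finite even cardinality. For $e\in[p]$, the restriction $\mathcal{P}_{\{e\}}$ is the partition $\{P\cap(\{e\}\times[2]\times[2]):P\in\mathcal{P}\}\smallsetminus\{\emptyset\}$ of $\{e\}\times[2]\times[2]$. $\mathcal{P}$ is globally even, locally odd (GELO) if $\mathcal{P}$ is even but $\mathcal{P}_{\{e\}}$ is not even for every $e\in[p]$. $\mathcal{P}$ is contributory if it is both GELO and satisfiable; $\mathrm{Con}(p)$ is the set of contributory partitions in $\mathrm{Part}(p)$. *)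

(* Defs.v *)
From HB Require Import structures.
From mathcomp Require Import all_boot all_order all_algebra.
From mathcomp Require Import finmap.
From mathcomp Require Import boolp classical_sets functions cardinality fsbigop.

Set Implicit Arguments.
Unset Strict Implicit.
Unset Printing Implicit Defensive.
Import Order.TTheory GRing.Theory Num.Theory.
Local Open Scope ring_scope.

(** The complex numbers are represented by an arbitrary
    [C : numClosedFieldType]; [algC] and [R[i]], for [R] a real closed field,
    are instances. *)

Definition binary_seq (C : numClosedFieldType) (l : nat) : set (int -> C) :=
  [set f | forall j : int, if (0 <= j) && (j < l%:Z)
                           then f j = -1 \/ f j = 1 else f j = 0]%classic.

Arguments binary_seq : clear implicits.

Lemma card_binary_seq (C : numClosedFieldType) (l : nat) :
  (binary_seq C l #= `I_(2 ^ l))%card.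
Proof.
have N11 : (-1 != 1 :> C) by rewrite eq_sym -subr_eq0 opprK -mulr2n pnatr_eq0.
pose h (g : {ffun 'I_l -> bool}) (j : int) : C :=
  if j is Posz n then (if insub n is Some i then (-1) ^+ g i else 0) else 0.
have hE g (i : 'I_l) : h g (i : nat)%:Z = (-1) ^+ g i.
  by rewrite /h valK.
have -> : binary_seq C l = (h @` [set: {ffun 'I_l -> bool}])%classic.
  apply/seteqP; split => [f Hf|_ [g _ <-] j].
    exists [ffun i : 'I_l => f (i : nat)%:Z == -1] => //.
    apply/funext => -[n|n]; have := Hf; last by move/(_ (Negz n)).
    move/(_ n%:Z) => /=; rewrite ltz_nat; case: insubP => [i -> <-|/negbTE->//].
    rewrite ffunE => -[] ->; first by rewrite eqxx.
    by rewrite eq_sym (negbTE N11).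
  case: j => [n|n] //=; rewrite ltz_nat.
  case: insubP => [i -> _|/negbTE->//].
  by case: (g i); [left|right]; rewrite ?expr1 ?expr0.
have inj_h : injective h.
  move=> g1 g2 E; apply/ffunP => i; have := hE g1 i; rewrite E hE.
  by case: (g1 i) (g2 i) => -[] //= /eqP; rewrite ?[1 == _]eq_sym (negbTE N11).
have <- : #|{: {ffun 'I_l -> bool}}| = (2 ^ l)%N.
  by rewrite card_ffun card_bool card_ord.
rewrite (card_eql (inj_card_eq (in2W inj_h))) (card_eqr card_II).
have -> : [set: 'I_#|{: {ffun 'I_l -> bool}}|]%classic =
          (enum_rank @` [set: {ffun 'I_l -> bool}])%classic.
  by apply/seteqP; split => // i _; exists (enum_val i); rewrite ?enum_valK.
by rewrite (card_eqr (inj_card_eq (in2W enum_rank_inj))).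
Qed.

(** [\sum_(i \in A) F i] is the sum over the support of [F] in [A] when that
    support is finite (and [0] otherwise).  For a binary sequence all supports
    below are finite. *)

Definition autocorrelation (C : numClosedFieldType) (f : int -> C) (s : int)
  : C := \sum_(j \in [set: int]%classic) (f (j + s) * (f j)^*).

Definition SSAC (C : numClosedFieldType) (f : int -> C) : C :=
  \sum_(s \in [set: int]%classic) `|autocorrelation f s| ^+ 2.

Definition expectation (C : numClosedFieldType) (l : nat)
    (v : (int -> C) -> C) : C :=
  (\sum_(f \in binary_seq C l) v f) / #|` fset_set (binary_seq C l)|%:R.

Definition central_moment (C : numClosedFieldType) (p l : nat)
    (v : (int -> C) -> C) : C :=
  expectation l (fun f => (v f - expectation l v) ^+ p).

(** [[p] x [2] x [2]]; the triple [(e, s, v)] is [((e, s), v)]. *)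
Definition pos (p : nat) : finType := ('I_p * 'I_2 * 'I_2)%type.

Definition Part (p : nat) : {set {set {set pos p}}} :=
  [set P | finset.partition P [set: pos p]]%SET.

Definition As (p : nat) (P : {set {set pos p}}) : set (pos p -> nat) :=
  [set tau |
     (forall b g : pos p,
        tau b = tau g <-> exists2 A, A \in P & (b \in A) /\ (g \in A))
   /\ (forall e : 'I_p,
        tau (e, ord0, ord0) + tau (e, ord0, ord_max)
        = tau (e, ord_max, ord0) + tau (e, ord_max, ord_max))%N
  ]%classic.

(** Functions with all values in [[l]] are finite functions into ['I_l]. *)
Definition As_lt (p : nat) (P : {set {set pos p}}) (l : nat)
  : {set {ffun pos p -> 'I_l}} :=
  [set tau : {ffun pos p -> 'I_l} | `[< As P (fun b => val (tau b)) >]]%SET.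

Definition satisfiable (p : nat) (P : {set {set pos p}}) : Prop :=
  exists tau, As P tau.

Definition even_partition (T : finType) (P : {set {set T}}) : bool :=
  [forall A in P, ~~ odd #|A|].

Definition restriction (p : nat) (P : {set {set pos p}}) (e : 'I_p)
  : {set {set pos p}} :=
  ([set A :&: [set b : pos p | b.1.1 == e] | A in P] :\ finset.set0)%SET.

Definition GELO (p : nat) (P : {set {set pos p}}) : bool :=
  even_partition P && [forall e : 'I_p, ~~ even_partition (restriction P e)].

Definition Con (p : nat) : {set {set {set pos p}}} :=
  [set P in Part p | GELO P && `[< satisfiable P >]]%SET.

(* Main.v *)
(** Expanding the autocorrelations gives SSAC(f) as the sum of
    f_a f_b f_c f_d over the quadruples of [[l]] with a + b = c + d.  A monomial
    in the f_i has mean 1 if every variable has even exponent and 0 otherwise,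
    and in the former case it is identically 1; so subtracting the mean just
    deletes the quadruples with even fibers.  The p-th power of what remains is
    a sum of monomials over the functions tau on [p] x [2] x [2] all of whose
    rows are balanced and have some odd fiber, and taking the mean keeps those
    with globally even fibers.  Sorting these tau by the partition of
    [p] x [2] x [2] into fibers gives the result. *)

Require Import Defs.
From mathcomp Require Import all_boot all_order all_algebra.
From mathcomp Require Import finmap zify ring.
From mathcomp Require Import boolp classical_sets functions cardinality fsbigop.

Set Implicit Arguments.
Unset Strict Implicit.
Unset Printing Implicit Defensive.
Import Order.TTheory GRing.Theory Num.Theory.

Local Open Scope ring_scope.

(** The support in [s] lies in the finite image of [u], and each [q] is met only at [s = u q]. This
    removes the infinite sums, over positions in [autocorrelation] and over shifts in [SSAC]. *)
Lemma fsum_fibers (V : nmodType) (I : choiceType) (T : finType)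
    (u : T -> I) (w : T -> V) :
  \sum_(s \in [set: I]%classic) \sum_(q | u q == s) w q = \sum_q w q.
Proof.
have uA q : u q \in [fset u x | x in T]%fset.
  by apply/imfsetP; exists q.
rewrite (@fsbigTE _ _ _ _ [fset u q | q in T]%fset) => [|s sA]; last first.
  by rewrite big_pred0 // => q; apply: contraNF sA => /eqP <-.
rewrite (exchange_big_dep xpredT) //=; apply: eq_bigr => q _.
under eq_bigl do rewrite eq_sym.
by rewrite -big_filter filter_pred1_uniq ?fset_uniq // big_seq1.
Qed.

(** * Binary sequences parametrized by bit vectors, with [true] standing for -1 *)

Definition sign_seq (C : numClosedFieldType) (l : nat)
    (g : {ffun 'I_l -> bool}) (j : int) : C :=
  \sum_(i : 'I_l | (i : nat)%:Z == j) (-1) ^+ g i.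

Arguments sign_seq : clear implicits.

Lemma sign_seq_ord (C : numClosedFieldType) (l : nat)
    (g : {ffun 'I_l -> bool}) (i : 'I_l) :
  sign_seq C l g (i : nat)%:Z = (-1) ^+ g i.
Proof. by rewrite /sign_seq (big_pred1 i). Qed.

Lemma sign_seq_notin (C : numClosedFieldType) (l : nat)
    (g : {ffun 'I_l -> bool}) (j : int) :
  (0 <= j) && (j < l%:Z) = false -> sign_seq C l g j = 0.
Proof.
move=> jl; rewrite /sign_seq big_pred0 // => i.
by apply: contraFF jl => /eqP <-; rewrite ltz_nat ltn_ord.
Qed.

Lemma N1_neq1 (C : numClosedFieldType) : (-1 == 1 :> C) = false.
Proof. by rewrite eq_sym -subr_eq0 opprK -mulr2n pnatr_eq0. Qed.

Lemma binary_seqE (C : numClosedFieldType) (l : nat) :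
  binary_seq C l = (sign_seq C l @` [set: {ffun 'I_l -> bool}])%classic.
Proof.
apply/seteqP; split => [f Hf|_ [g _ <-] j].
  exists [ffun i : 'I_l => f (i : nat)%:Z == -1] => //.
  apply/funext => j; have := Hf j; case: ifP => [|jl ->].
    case: j => // n; rewrite ltz_nat /= => nl.
    rewrite -[n]/(val (Ordinal nl)) sign_seq_ord ffunE => -[] ->.
      by rewrite eqxx.
    by rewrite eq_sym N1_neq1.
  by rewrite sign_seq_notin.
case: ifP => [|Hj].
  case: j => // n; rewrite ltz_nat /= => nl.
  rewrite -[n]/(val (Ordinal nl)) sign_seq_ord.
  by case: (g _); [left|right]; rewrite ?expr1 ?expr0.
exact: sign_seq_notin.
Qed.

Lemma sign_seq_inj (C : numClosedFieldType) (l : nat) :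
  injective (sign_seq C l).
Proof.
move=> g1 g2 E; apply/ffunP => i; have := sign_seq_ord C g1 i.
rewrite E sign_seq_ord.
by case: (g1 i) (g2 i) => -[] //= /eqP; rewrite ?[1 == _]eq_sym N1_neq1.
Qed.

Lemma expectationE (C : numClosedFieldType) (l : nat) (v : (int -> C) -> C) :
  expectation l v =
  (\sum_(g : {ffun 'I_l -> bool}) v (sign_seq C l g)) / (2 ^ l)%:R.
Proof.
rewrite /expectation (card_fset_set (card_binary_seq C l)) binary_seqE.
rewrite fsbig_image; last by move=> x y _ _; exact: sign_seq_inj.
rewrite (@fsbigE _ _ _ _ _ (index_enum {ffun 'I_l -> bool})) ?index_enum_uniq //.
  by congr (_ / _); apply: eq_bigl => g; rewrite in_setT.
by move=> g _; rewrite mem_index_enum.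
Qed.

(** * Monomials in the signs and their means *)

Section SignProduct.
Variables (C : numClosedFieldType) (l : nat) (B : finType).
Implicit Types (g : {ffun 'I_l -> bool}) (t : {ffun B -> 'I_l}).

Definition sign_prod g t : C := \prod_b (-1) ^+ g (t b).

Definition even_fibers t : bool := [forall i, ~~ odd #|[set b | t b == i]|].

(** Grouping the factors by the value of [t] raises each sign to the size of a fiber; signs square
    to 1, so only the parity matters. *)
Lemma sign_prodE g t :
  sign_prod g t = \prod_i ((-1) ^+ g i) ^+ odd #|[set b | t b == i]|.
Proof.
rewrite /sign_prod (partition_big t xpredT) //=; apply: eq_bigr => i _.
rewrite (eq_bigr (fun=> (-1) ^+ g i)) => [|b /eqP -> //].
rewrite prodr_const cardsE.
by case: (g i); rewrite ?expr0 ?expr1n // expr1 signr_odd.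
Qed.

Lemma sign_prod_even g t : even_fibers t -> sign_prod g t = 1.
Proof.
move=> /forallP te; rewrite sign_prodE big1 // => i _.
by rewrite (negbTE (te i)) expr0.
Qed.

Lemma sum_sign_prod t :
  \sum_g sign_prod g t = (2 ^ l * even_fibers t)%:R.
Proof.
have [te|] := boolP (even_fibers t).
  under eq_bigr do rewrite sign_prod_even //.
  by rewrite sumr_const card_ffun card_bool card_ord muln1.
move=> /forallPn[i]; rewrite negbK => ti.
under eq_bigr do rewrite sign_prodE.
(* The sum over all [g] factors index by index, and the index [i] with odd fiber contributes -1 + 1
   = 0. *)
rewrite -(bigA_distr_bigA (fun i (b : bool) =>
  ((-1) ^+ b : C) ^+ odd #|[set b | t b == i]|)).
by rewrite (bigD1 i) //= big_bool ti /= addNr mul0r muln0.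
Qed.

End SignProduct.

(** * SSAC as a sum of monomials over balanced quadruples, its mean and its deviation *)

Definition row_t (l : nat) : finType := {ffun 'I_2 * 'I_2 -> 'I_l}.

Definition balanced (l : nat) (q : row_t l) : bool :=
  (q (ord0, ord0) + q (ord0, ord_max)
   == q (ord_max, ord0) + q (ord_max, ord_max))%N.

Lemma autocorrelationE (C : numClosedFieldType) (l : nat)
    (g : {ffun 'I_l -> bool}) (s : int) :
  autocorrelation (sign_seq C l g) s =
  \sum_(x : 'I_l * 'I_l | (x.1 : nat)%:Z - (x.2 : nat)%:Z == s)
     (-1) ^+ g x.1 * (-1) ^+ g x.2.
Proof.
rewrite /autocorrelation.
(* Only the second factor is expanded at first, so that the sum over [j] collapses by [fsum_fibers].
   Zero values outside the range become empty sums. *)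
transitivity (\sum_(j \in [set: int]%classic)
   \sum_(i : 'I_l | (i : nat)%:Z == j)
      sign_seq C l g ((i : nat)%:Z + s) * (-1) ^+ g i).
  apply: eq_fsbigr => j _; rewrite {2}/sign_seq rmorph_sum mulr_sumr /=.
  by apply: eq_bigr => i /eqP ->; rewrite rmorph_sign.
rewrite fsum_fibers.
under eq_bigr do rewrite mulr_suml.
rewrite (exchange_big_dep xpredT) //= pair_big_dep /=.
by apply: eq_bigl => x; lia.
Qed.

Lemma SSACE (C : numClosedFieldType) (l : nat) (g : {ffun 'I_l -> bool}) :
  SSAC (sign_seq C l g) = \sum_(q : row_t l | balanced q) sign_prod C g q.
Proof.
pose d (x : 'I_l * 'I_l) := (x.1 : nat)%:Z - (x.2 : nat)%:Z.
pose w (x : 'I_l * 'I_l) : C := (-1) ^+ g x.1 * (-1) ^+ g x.2.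
(* The square ranges over two pairs, both of difference [s]. The second constraint is moved into the
   summand as [d y.1 == d y.2], which leaves the shape of [fsum_fibers]. *)
transitivity (\sum_(s \in [set: int]%classic)
    \sum_(y | d y.1 == s) if d y.1 == d y.2 then w y.1 * w y.2 else 0).
  apply: eq_fsbigr => s _; rewrite autocorrelationE normCK.
  rewrite (_ : (_ ^*)%R = \sum_(x | d x == s) w x); last first.
    by rewrite rmorph_sum; apply: eq_bigr => x _; rewrite rmorphM !rmorph_sign.
  rewrite big_distrlr pair_big -big_mkcondr /=.
  by apply: eq_bigl => y; rewrite -!/(d _); case: eqP => //= ->; rewrite eq_sym.
rewrite fsum_fibers -big_mkcond /=.
(* The pairs are chosen so that equal differences q00 - q10 = q11 - q01 amount to q00 + q01 = q10 +
   q11; [k] is the inverse of [h]. *)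
pose h (q : row_t l) := ((q (ord0, ord0), q (ord_max, ord0)),
  (q (ord_max, ord_max), q (ord0, ord_max))).
pose k (y : ('I_l * 'I_l) * ('I_l * 'I_l)) : row_t l :=
  [ffun x => if x.1 == ord0 then if x.2 == ord0 then y.1.1 else y.2.2
             else if x.2 == ord0 then y.1.2 else y.2.1].
rewrite (reindex h) /=; last first.
  exists k => [q _|[[a b] [c e]] _]; last by rewrite /h !ffunE.
  by apply/ffunP => -[[[|[|//]] ?] [[|[|//]] ?]]; rewrite ffunE /=;
    congr (q (_, _)); apply: val_inj.
apply: eq_big => [q|q _]; first by rewrite /d /balanced /=; lia.
rewrite /sign_prod (eq_bigr (fun b => (-1) ^+ g (q (b.1, b.2)))) => [|[]//].
rewrite -(pair_bigA _ (fun i j => (-1) ^+ g (q (i, j)))) /=.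
rewrite !big_ord_recl !big_ord0 /w /= !mulr1.
rewrite (_ : lift ord0 ord0 = ord_max); last exact: val_inj.
by ring.
Qed.

Lemma mean_SSAC (C : numClosedFieldType) (l : nat) :
  expectation l (@SSAC C) = \sum_(q : row_t l | balanced q) (even_fibers q)%:R.
Proof.
rewrite expectationE; under eq_bigr do rewrite SSACE.
rewrite exchange_big mulr_suml /=; apply: eq_bigr => q _.
by rewrite sum_sign_prod natrM mulrAC divff ?mul1r // pnatr_eq0 expn_eq0.
Qed.

Lemma SSAC_deviation (C : numClosedFieldType) (l : nat)
    (g : {ffun 'I_l -> bool}) :
  SSAC (sign_seq C l g) - expectation l (@SSAC C) =
  \sum_(q : row_t l | balanced q && ~~ even_fibers q) sign_prod C g q.
Proof.
rewrite SSACE mean_SSAC -sumrB big_mkcondr /=; apply: eq_bigr => q _.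
by case: (boolP (even_fibers q)) => /= qe; rewrite ?subr0 // sign_prod_even ?subrr.
Qed.

(** * Partitions into fibers *)

Lemma mem_preim_partition (T : finType) (R : eqType) (f : T -> R) (A : {set T}) :
  (A \in preim_partition f [set: T]) = [exists x, A == [set y | f x == f y]].
Proof.
apply/imsetP/existsP => [[x _ ->]|[x /eqP ->]]; exists x => //.
  by apply/eqP/setP => y; rewrite !inE.
by apply/setP => y; rewrite !inE.
Qed.

(** Condition (a) of [As] thus becomes an equation for [P], so that each assignment belongs to
    exactly one partition. *)
Lemma preim_partition_eqP (T : finType) (R : eqType) (f : T -> R)
    (P : {set {set T}}) : finset.partition P [set: T] ->
  reflect (forall x y, f x = f y <-> exists2 A, A \in P & x \in A /\ y \in A)
          (P == preim_partition f [set: T]).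
Proof.
move=> Ppart; apply: (iffP eqP) => [->|H].
  move=> x y; split=> [fxy|[A]].
    exists [set y | f x == f y]; last by rewrite !inE fxy eqxx.
    by rewrite mem_preim_partition; apply/existsP; exists x.
  by rewrite mem_preim_partition => /existsP[z /eqP->]; rewrite !inE => -[/eqP<- /eqP].
have [/eqP cP tP n0] := and3P Ppart.
(* Once [P] is seen as the fiber partition of its own block map, the two sides can be compared point
   by point. *)
rewrite -[LHS](preim_partition_pblock Ppart).
apply: eq_in_imset => x _; apply/setP => y; rewrite !inE /=.
have xP z : z \in finset.cover P by rewrite cP inE.
rewrite eq_pblock //; apply/idP/eqP => [xy|/H[A AP [xA yA]]].
  by apply/H; exists (finset.pblock P x); rewrite ?pblock_mem ?mem_pblock.
by rewrite (def_pblock tP AP xA).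
Qed.

(** * Functions on [p] x [2] x [2] as families of rows, and the central moment as a count *)

Section Rows.
Variables (p l : nat).
Implicit Types t : {ffun pos p -> 'I_l}.

Definition row_of t (e : 'I_p) : row_t l := [ffun x => t (e, x.1, x.2)].

Definition of_rows (F : {ffun 'I_p -> row_t l}) : {ffun pos p -> 'I_l} :=
  [ffun b => F b.1.1 (b.1.2, b.2)].

Lemma of_rowsK F e : row_of (of_rows F) e = F e.
Proof. by apply/ffunP => -[x y]; rewrite !ffunE. Qed.

Lemma of_rows_bij : bijective of_rows.
Proof.
exists (fun t => [ffun e => row_of t e]) => [F|t].
  by apply/ffunP => e; rewrite ffunE of_rowsK.
by apply/ffunP => -[[e s] v]; rewrite !ffunE.
Qed.

Lemma prod_row_of (C : numClosedFieldType) (g : {ffun 'I_l -> bool}) t :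
  \prod_e sign_prod C g (row_of t e) = sign_prod C g t.
Proof.
rewrite /sign_prod [RHS](eq_bigr (fun b => (-1) ^+ g (t (b.1.1, b.1.2, b.2))));
  last by move=> [[]].
rewrite -(pair_bigA _ (fun i v => (-1) ^+ g (t (i.1, i.2, v)))) /=.
rewrite -(pair_bigA _ (fun e s => \prod_v (-1) ^+ g (t (e, s, v)))) /=.
apply: eq_bigr => e _; rewrite pair_bigA /=.
by apply: eq_bigr => x _; rewrite ffunE.
Qed.

Definition contributes t : bool :=
  [forall e, balanced (row_of t e)] &&
  (even_fibers t && [forall e, ~~ even_fibers (row_of t e)]).

Lemma central_momentE (C : numClosedFieldType) :
  central_moment p l (@SSAC C) = #|[set t | contributes t]|%:R.
Proof.
rewrite /central_moment expectationE.
pose good q : bool := @balanced l q && ~~ even_fibers q.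
transitivity ((\sum_(g : {ffun 'I_l -> bool})
    \sum_(t : {ffun pos p -> 'I_l} | [forall e, good (row_of t e)])
      sign_prod C g t) / (2 ^ l)%:R).
  congr (_ / _); apply: eq_bigr => g _.
  (* The power is a product over ['I_p]; distributing it chooses one row for each [e], and [of_rows]
     glues these into a single function. *)
  rewrite SSAC_deviation -[p in _ ^+ p]card_ord -prodr_const bigA_distr_big /=.
  rewrite [RHS](reindex of_rows) /=; last exact/onW_bij/of_rows_bij.
  apply: eq_big => [F|F _].
    apply/ffun_onP/forallP => H e; have := H e; by rewrite of_rowsK.
  by rewrite -prod_row_of; apply: eq_bigr => e _; rewrite of_rowsK.
rewrite exchange_big mulr_suml /=.
rewrite -sum1_card natr_sum big_mkcond [RHS]big_mkcond /=.
apply: eq_bigr => t _; rewrite inE sum_sign_prod natrM mulrAC divff; last first.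
  by rewrite pnatr_eq0 expn_eq0.
rewrite mul1r /contributes.
have -> : [forall e, good (row_of t e)] =
  [forall e, balanced (row_of t e)] && [forall e, ~~ even_fibers (row_of t e)].
  apply/forallP/andP => [H|[/forallP H1 /forallP H2] e]; last by rewrite /good H1 H2.
  by split; apply/forallP => e; case/andP: (H e).
by case: (even_fibers t); do 2 case: [forall _, _].
Qed.

Lemma As_ltE (P : {set {set pos p}}) t : P \in Part p ->
  (t \in As_lt P l) =
  (P == preim_partition t [set: pos p]) && [forall e, balanced (row_of t e)].
Proof.
rewrite !inE => Ppart.
(* [As] speaks of values in [nat]; ordinals are compared through these values, so the fibers are the
   same. *)
have HP : (P == preim_partition t [set: pos p]) =
   (P == preim_partition (fun b => val (t b)) [set: pos p]).
  by congr (_ == _).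
rewrite HP; apply/asboolP/andP => [[H1 H2]|[/(preim_partition_eqP _ Ppart) H1 /forallP H2]].
  split; first exact/(preim_partition_eqP _ Ppart).
  by apply/forallP => e; rewrite /balanced !ffunE /= H2.
by split => // e; have /eqP := H2 e; rewrite !ffunE.
Qed.

Lemma even_preim_partition t :
  even_partition (preim_partition t [set: pos p]) = even_fibers t.
Proof.
apply/forall_inP/forallP => [H i|H A].
  (* An index that [t] misses gives no class, but its empty fiber is even. *)
  have [->|[b]] := set_0Vmem [set b | t b == i]; first by rewrite cards0.
  rewrite inE => /eqP <-; apply: H; rewrite mem_preim_partition.
  by apply/existsP; exists b; apply/eqP/setP => y; rewrite !inE eq_sym.
rewrite mem_preim_partition => /existsP[x /eqP ->].
by have := H (t x); under eq_finset do rewrite eq_sym.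
Qed.

(** Links restriction of a partition with restriction of a function: x -> (e, x) maps the fiber of
    the row bijectively onto the trace on row [e]. *)
Lemma card_row_fiber t e i :
  #|[set b | t b == i] :&: [set b : pos p | b.1.1 == e]| =
  #|[set x | row_of t e x == i]|.
Proof.
rewrite -(card_imset _ (f := fun x : 'I_2 * 'I_2 => (e, x.1, x.2) : pos p)).
  apply: eq_card => -[[e' s] v]; rewrite !inE /=.
  apply/andP/imsetP => [[ti /eqP <-]|[[a b]]].
    by exists (s, v) => //; rewrite inE ffunE.
  by rewrite inE ffunE /= => ti [-> -> ->].
by move=> [a b] [c d] [-> ->].
Qed.

Lemma even_restriction t e :
  even_partition (restriction (preim_partition t [set: pos p]) e) =
  even_fibers (row_of t e).
Proof.
apply/forall_inP/forallP => [H i|H A].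
  rewrite -card_row_fiber.
  (* Empty traces are excluded from [restriction], but they have even size. *)
  set A := _ :&: _; have [->|[b bA]] := set_0Vmem A; first by rewrite cards0.
  apply: H; rewrite !inE; apply/andP; split; first by apply/set0Pn; exists b.
  apply/imsetP; exists [set b | t b == i] => //.
  rewrite mem_preim_partition; apply/existsP; exists b.
  move: bA; rewrite !inE => /andP[/eqP <- _].
  by apply/eqP/setP => y; rewrite !inE eq_sym.
rewrite !inE => /andP[_ /imsetP[B]]; rewrite mem_preim_partition.
move=> /existsP[x /eqP ->] ->; have := H (t x); rewrite -card_row_fiber.
by under eq_finset do rewrite eq_sym.
Qed.

Lemma contributesE t :
  contributes t = [forall e, balanced (row_of t e)] &&
                  (preim_partition t [set: pos p] \in Con p).
Proof.
rewrite /contributes; case: (boolP [forall e, _]) => //= bal.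
have Ppart : preim_partition t [set: pos p] \in Part p.
  by rewrite inE preim_partitionP.
rewrite inE Ppart /= /GELO even_preim_partition.
under eq_forallb do rewrite -even_restriction.
rewrite [X in _ = _ && X]asboolT ?andbT //.
(* The balanced [t] is itself an assignment for its fiber partition, which is therefore
   satisfiable. *)
exists (fun b => val (t b)); apply/asboolP.
by have := As_ltE t Ppart; rewrite eqxx bal inE.
Qed.

End Rows.

Theorem proposition3p1 (C : numClosedFieldType) (p l : nat) :
  central_moment p l (@SSAC C) = \sum_(P in Con p) #|As_lt P l|%:R.
Proof.
rewrite central_momentE -natr_sum; congr (_%:R).
transitivity (\sum_(P in Con p) \sum_(t in As_lt P l) 1)%N; last first.
  by apply: eq_bigr => P _; rewrite sum1_card.
(* The contributing functions are sorted by fiber partition; by [As_ltE] those over [P] are exactly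
   the members of [As_lt P l]. *)
rewrite -sum1_card (partition_big (fun t : {ffun pos p -> 'I_l} =>
  preim_partition t [set: pos p]) (mem (Con p))) /=.
  apply: eq_bigr => P PC; apply: eq_bigl => t.
  have PP : P \in Part p by move: PC; rewrite inE => /andP[].
  rewrite inE contributesE As_ltE // eq_sym andbC.
  by case: eqP => //= <-; rewrite ?PC andbT.
by move=> t; rewrite inE contributesE => /andP[].
Qed.
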